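(* Let $\mu\in\mathbb{R}$, $\tau>0$, let $s_1,\ldots,s_n$ be distinct locations, and let $\rho_{ij}=\rho(\|s_i-s_j\|;\psi)$, where $\rho(\cdot;\psi)$ is a correlation function with parameter $\psi$. Let $(z_{ik})_{1\le i\le n,\,k\ge1}$ be generated by the spatially dependent Indian buffet process (sIBP) with parameters $\mu$, $\tau$ and correlation matrix $Q(\psi)=(\rho_{ij})_{i,j}$. For $\rho\in[-1,1]$ define $$ D_{\mu,\tau}(\rho)=\mathbb{E}[\sigma(U)\sigma(V)],\qquad (U,V)\sim\mathcal{N}_2\left(\begin{pmatrix}\mu\\ \mu\end{pmatrix},\ \frac1\tau\begin{pmatrix}1&\rho\\ \rho&1\end{pmatrix}\right), $$ where $\sigma(x)=1/(1+e^{-x})$. Then for all $i\neq j$ in $\{1,\ldots,n\}$ and all $k\ge 1$, $$ \mathbb{P}(z_{ik}=1,\ z_{jk}=1)=D_{\mu,\tau}(\rho_{ij})^k. $$ Furthermore, $D_{\mu,\tau}(\rho)$ is an increasing function of $\rho\in(0,1)$.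
   Context: The sIBP with parameters $\mu,\tau,Q(\psi)$: for $k=1,2,\ldots$ let $u_k=(u_{1k},\ldots,u_{nk})\sim\mathcal{N}(\mu 1_n,\tau^{-1}Q(\psi))$ independently over $k$, where $1_n$ is the all-ones vector and $Q(\psi)$ is the correlation matrix with $(i,j)$ entry $\rho_{ij}=\rho(\|s_i-s_j\|;\psi)$ (positive semidefinite with unit diagonal; e.g. $\rho(d;\psi)=\exp(-d/\psi)$, $\psi>0$). Set $b_{ik}=\prod_{h=1}^k\sigma(u_{ih})$. Given all the $u_{ik}$, the entries $z_{ik}\in\{0,1\}$ are conditionally independent with $z_{ik}\sim\mathrm{Bernoulli}(b_{ik})$. *)

(* Defs.v *)
From HB Require Import structures.
From mathcomp Require Import all_boot all_order all_algebra.
From mathcomp Require Import finmap.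
From mathcomp Require Import all_classical all_reals all_analysis.
From mathcomp Require Import measurable_realfun.

Set Implicit Arguments.
Unset Strict Implicit.
Unset Printing Implicit Defensive.

Import Order.TTheory GRing.Theory Num.Theory.
Import numFieldNormedType.Exports.

Local Open Scope classical_set_scope.
Local Open Scope ring_scope.

Definition sigmoid (R : realType) (x : R) : R := (1 + expR (- x))^-1.

Definition psd (R : realType) (n : nat) (S : 'M[R]_n) : Prop :=
  S^T = S /\ forall v : 'cV[R]_n, 0 <= (v^T *m S *m v) 0 0.

Definition corr_mx (R : realType) (V : normedModType R) (r : R -> R)
    (n : nat) (s : 'I_n -> V) : 'M[R]_n :=
  \matrix_(i, j) r `|s i - s j|.

(* Isotropic correlation functions on V: the matrices of all finite
   configurations of points are correlation matrices. *)
Definition correlation_function (R : realType) (V : normedModType R)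
    (r : R -> R) : Prop :=
  r 0 = 1 /\ forall (m : nat) (x : 'I_m -> V), psd (corr_mx r x).

Section iid.
Context (d : measure_display) (T : measurableType d) (R : realType).

Definition tcons (n : nat) (x : T * n.-tuple T) : n.+1.-tuple T :=
  [tuple of x.1 :: x.2].

Lemma measurable_tcons n : measurable_fun [set: T * n.-tuple T] (@tcons n).
Proof. exact: measurable_cons. Qed.

HB.instance Definition _ n :=
  @isMeasurableFun.Build _ _ _ _ (@tcons n) (@measurable_tcons n).

(* The product measure P^n on n.-tuple T. *)
Fixpoint iid (P : probability T R) (n : nat) : probability (n.-tuple T) R :=
  if n is m.+1 then distribution (P \x iid P m)%E (@tcons m)
  else \d_[tuple].

End iid.

Section multivariate_normal.
Context (R : realType) (n : nat) (m : 'cV[R]_n).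

(* [measurableTypeR R] is R with its Borel sets, on which the library states
   [normal_prob]. *)
Definition affine (A : 'M[R]_n) (x : n.-tuple (measurableTypeR R)) :
    n.-tuple R :=
  [tuple (m + A *m (\col_j tnth x j)) i 0 | i < n].

Lemma measurable_affine A : measurable_fun [set: n.-tuple (measurableTypeR R)] (affine A).
Proof.
apply/measurable_fun_tnthP => i.
rewrite (_ : _ \o _ = fun x => m i 0 + \sum_j A i j * tnth x j); last first.
  apply/funext => x /=; rewrite tnth_mktuple !mxE; congr (_ + _).
  by apply: eq_bigr => j _; rewrite mxE.
apply: measurable_funD; first exact: measurable_cst.
apply: measurable_sum => j.
apply: measurable_funM; first exact: measurable_cst.
exact: measurable_tnth.
Qed.

HB.instance Definition _ A :=
  @isMeasurableFun.Build _ _ _ _ (affine A) (measurable_affine A).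

(* N(m, S), for S positive semidefinite and possibly singular: the law of
   m + A Z, where A A^T = S and Z has independent standard normal coordinates.
   This law does not depend on the factor A picked by [xget]; if S is not
   positive semidefinite there is no factor and the value is irrelevant. *)
Definition mvnormal (S : 'M[R]_n) : probability (n.-tuple R) R :=
  distribution (iid (normal_prob 0 1) n)
    (affine (xget 0 [set A : 'M[R]_n | A *m A^T = S])).

End multivariate_normal.

Definition corr2 (R : realType) (rho : R) : 'M[R]_2 :=
  \matrix_(i, j) (if i == j then 1 else rho).

Definition Dfun (R : realType) (mu tau rho : R) : R :=
  fine ('E_(mvnormal (const_mx mu) (tau^-1 *: corr2 rho))
    [fun x : 2.-tuple R => (sigmoid (tnth x 0) * sigmoid (tnth x 1))%R])%E.

Section independence.
Context (d : measure_display) (T : measurableType d) (R : realType).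
Variable P : probability T R.

Definition mutually_independent (d' : measure_display) (T' : measurableType d')
    (I : choiceType) (X : I -> {RV P >-> T'}) : Prop :=
  forall (J : {fset I}) (B : I -> set T'), (forall i, measurable (B i)) ->
    P (\bigcap_(i in [set` J]) (X i @^-1` B i))
    = (\prod_(i <- J) fine (P (X i @^-1` B i)))%:E.

(* Y is a version of the conditional probability of the event A given the
   sigma-algebra <<s G >>. *)
Definition is_cond_prob (G : set (set T)) (A : set T) (Y : T -> R) : Prop :=
  [/\ measurable_fun [set: g_sigma_algebraType G] (Y : g_sigma_algebraType G -> R),
      P.-integrable [set: T] (EFin \o Y) &
      forall B, <<s G >> B -> (\int[P]_(w in B) (Y w)%:E = P (A `&` B))%E].

Definition cond_law (G : set (set T)) (d' : measure_display)
    (T' : measurableType d') (X : {RV P >-> T'})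
    (kappa : T -> set T' -> \bar R) : Prop :=
  forall C : set T', measurable C ->
    is_cond_prob G (X @^-1` C) (fun w => fine (kappa w C)).

Definition cond_mutually_independent (G : set (set T)) (d' : measure_display)
    (T' : measurableType d') (I : choiceType) (X : I -> {RV P >-> T'}) : Prop :=
  forall (J : {fset I}) (B : I -> set T') (Y : I -> T -> R),
    (forall i, measurable (B i)) ->
    (forall i, is_cond_prob G (X i @^-1` B i) (Y i)) ->
    is_cond_prob G (\bigcap_(i in [set` J]) (X i @^-1` B i))
                   (fun w => \prod_(i <- J) Y i w).

End independence.

(* Columns are numbered from 0: [u k] and [z i k] stand for u_{k+1} and
   z_{i,k+1}. *)
Section sIBP.
Context (d : measure_display) (T : measurableType d) (R : realType).
Variables (P : probability T R) (n : nat).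

Definition stick (u : nat -> {RV P >-> n.-tuple R}) (i : 'I_n) (k : nat)
    (w : T) : R :=
  \prod_(h < k.+1) sigmoid (tnth (u h w) i).

(* Generates the sigma-algebra of all the u_{ik}. *)
Definition u_events (u : nat -> {RV P >-> n.-tuple R}) : set (set T) :=
  \bigcup_k preimage_set_system [set: T] (u k) measurable.

Record sIBP (mu tau : R) (Q : 'M[R]_n) (u : nat -> {RV P >-> n.-tuple R})
    (z : 'I_n -> nat -> {RV P >-> bool}) : Prop := {
  sIBP_normal : forall k B, measurable B ->
    distribution P (u k) B = mvnormal (const_mx mu) (tau^-1 *: Q) B ;
  sIBP_indep : mutually_independent u ;
  sIBP_bernoulli : forall i k,
    cond_law (u_events u) (z i k) (fun w => bernoulli_prob (stick u i k w)) ;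
  sIBP_cond_indep :
    cond_mutually_independent (u_events u) (fun p : 'I_n * nat => z p.1 p.2)
}.

End sIBP.

(* Main.v *)
(* Writing z_ik for the Bernoulli variables, the conditional independence gives
   P(z_ik = z_jk = 1) = E [prod_h sigma(u_ih) sigma(u_jh)], which factorizes by
   independence of the u_h. Each factor is D(rho_ij) because the law of a pair
   of linear forms in independent standard normal variables only depends on the
   Gram matrix of the forms, by rotation invariance.
   For rho1 < rho2, take independent standard normal W, W', X, Y and set
   U = a (sqrt rho1 W + sqrt (rho2 - rho1) W' + sqrt (1 - rho2) X) and the same
   for V with Y instead of X, where a ^ 2 = 1 / tau. With
   h(W, W') = E [sigma(mu + U) | W, W'] one gets D(rho2) = E [h(W, W') ^ 2],
   while D(rho1) = E [E [h(W, W') | W] ^ 2]; the first one is larger because,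
   W being fixed, h is strictly increasing in W' and hence not constant. *)
From HB Require Import structures.
Require Import Defs.
From mathcomp Require Import all_boot all_order all_algebra.
From mathcomp Require Import finmap.
From mathcomp Require Import all_classical all_reals all_analysis.
From mathcomp Require Import measurable_realfun.
From mathcomp Require Import ring lra.

Set Implicit Arguments.
Unset Strict Implicit.
Unset Printing Implicit Defensive.

Import Order.TTheory GRing.Theory Num.Theory.
Import numFieldNormedType.Exports.

Local Open Scope classical_set_scope.
Local Open Scope ring_scope.

(** * Change of variables with a density *)

Section density.
Context d d' (T : measurableType d) (S : measurableType d') (R : realType).
Variables (mu : {measure set T -> \bar R}) (nu : {measure set S -> \bar R}).
Variables (X : T -> S) (g : T -> R).
Hypothesis mX : measurable_fun setT X.
Hypothesis mg : measurable_fun setT g.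
Hypothesis g0 : forall x, 0 <= g x.
Hypothesis nuE :
  forall B, measurable B -> (\int[mu]_(x in X @^-1` B) (g x)%:E = nu B)%E.
Local Open Scope ereal_scope.
Import HBNNSimple.

(** The hypothesis says that [nu] is the image under [X] of the measure with density [g] with
    respect to [mu]. The identity passes from indicators to simple functions by linearity, then to
    [f] by monotone convergence. It is used with [X] the identity for the normal density, and with
    [X] one of several independent variables to split off a factor. *)
Lemma ge0_integral_density (f : S -> \bar R) :
  measurable_fun setT f -> (forall y, 0 <= f y) ->
  \int[mu]_x ((g x)%:E * f (X x)) = \int[nu]_y f y.
Proof.
move=> mf f0.
pose f_ := nnsfun_approx measurableT mf.
have mfX n : measurable_fun setT (fun x => (f_ n (X x))%:E).
  by apply/measurable_EFinP; exact: measurableT_comp.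
have simple n :
    \int[mu]_x ((g x)%:E * (f_ n (X x))%:E) = \int[nu]_y (f_ n y)%:E.
  have mXr r : measurable (X @^-1` (f_ n @^-1` [set r])).
    by rewrite -[_ @^-1` _]setTI; exact: mX.
  rewrite integralT_nnsfun sintegralE.
  transitivity (\int[mu]_x \sum_(r \in range (f_ n))
      (r%:E * ((g x)%:E * (\1_(X @^-1` (f_ n @^-1` [set r])) x)%:E))).
    apply: eq_integral => x _.
    rewrite [in LHS]fimfunE -fsumEFin// ge0_mule_fsumr; last first.
      by move=> r; rewrite nnfun_muleindic_ge0.
    by apply: eq_fsbigr => r _; rewrite EFinM muleCA.
  rewrite ge0_integral_fsum//; last 2 first.
  - move=> r; apply: emeasurable_funM => //; apply: emeasurable_funM => //.
    exact/measurable_EFinP.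
    exact/measurable_EFinP.
  - move=> r x _; rewrite muleCA; apply: mule_ge0 => //.
    + by rewrite lee_fin.
    + exact: nnfun_muleindic_ge0.
  apply: eq_fsbigr => r /[!inE] -[s _ sr].
  have r0 : (0 <= r)%R by rewrite -sr.
  rewrite ge0_integralZl//; last 2 first.
  - by apply: emeasurable_funM => //; exact/measurable_EFinP.
  - by move=> x _; apply: mule_ge0; rewrite lee_fin.
  by rewrite -nuE// [in RHS]integral_mkcond epatch_indic.
transitivity (limn (fun n => \int[mu]_x ((g x)%:E * (f_ n (X x))%:E))).
  rewrite -monotone_convergence//.
  - apply: eq_integral => x _; apply/esym/cvg_lim => //.
    apply: cvgeZl => //; exact: cvg_nnsfun_approx.
  - by move=> n; apply: emeasurable_funM => //; exact/measurable_EFinP.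
  - by move=> n x _; apply: mule_ge0; rewrite lee_fin.
  - move=> x _ m n mn; apply: lee_wpmul2l; first by rewrite lee_fin.
    by rewrite lee_fin; exact/lefP/nd_nnsfun_approx.
under eq_fun do rewrite simple.
rewrite -monotone_convergence//.
- by apply: eq_integral => y _; apply/cvg_lim => //; exact: cvg_nnsfun_approx.
- by move=> n; exact/measurable_EFinP.
- by move=> n y _; rewrite lee_fin.
- by move=> y _ m n mn; rewrite lee_fin; exact/lefP/nd_nnsfun_approx.
Qed.
End density.

Section probability_integral.
Context d (T : measurableType d) (R : realType) (P : probability T R).
Local Open Scope ereal_scope.

Lemma integral_probability_cst (c : \bar R) : \int[P]_x c = c.
Proof. by rewrite integral_cst//= probability_setT mule1. Qed.

Lemma fin_num_integral_probability (f : T -> R) : measurable_fun setT f ->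
  (forall x, 0 <= f x <= 1)%R -> \int[P]_x (f x)%:E \is a fin_num.
Proof.
move=> mf f01.
have f0 x : [set: T] x -> 0 <= (f x)%:E.
  by rewrite lee_fin; have /andP[] := f01 x.
rewrite ge0_fin_numE ?integral_ge0//.
apply: le_lt_trans (ltry 1); rewrite -[leRHS](integral_probability_cst 1).
apply: ge0_le_integral => //.
- exact/measurable_EFinP.
- by move=> x _; rewrite lee_fin; have /andP[] := f01 x.
Qed.

End probability_integral.

(** * Affine substitution in Lebesgue integrals on the line *)

Section affine_substitution.
Context (R : realType).
Local Notation leb := (@lebesgue_measure R).

Definition affine1 (c d : R) (x : measurableTypeR R) : measurableTypeR R :=
  c * x + d.

Lemma measurable_affine1 c d : measurable_fun setT (affine1 c d).
Proof. by apply: measurable_funD => //; exact: measurable_funM. Qed.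

HB.instance Definition _ c d :=
  @isMeasurableFun.Build _ _ _ _ (affine1 c d) (measurable_affine1 c d).

(** The image measure gets a name of its own so that it can carry a measure structure and be
    rescaled by [mscale]. *)
Definition lebesgue_affine1 c d (A : set (measurableTypeR R)) : \bar R :=
  leb (affine1 c d @^-1` A).

Let lebesgue_affine10 c d : lebesgue_affine1 c d set0 = 0%E.
Proof. by rewrite /lebesgue_affine1 preimage_set0. Qed.

Let lebesgue_affine1_ge0 c d A : (0 <= lebesgue_affine1 c d A)%E.
Proof. exact: measure_ge0. Qed.

Let lebesgue_affine1_sigma c d : semi_sigma_additive (lebesgue_affine1 c d).
Proof.
exact: (@measure_semi_sigma_additive _ _ _
  (measure_function_pushforward__canonical__measure_function_Measure
     leb (measurable_affine1 c d))).
Qed.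

HB.instance Definition _ c d := isMeasure.Build _ _ _ (lebesgue_affine1 c d)
  (lebesgue_affine10 c d) (lebesgue_affine1_ge0 c d)
  (lebesgue_affine1_sigma (d:=d)).

Variables (c d : R).
Hypothesis c0 : c != 0.

(** By uniqueness of Lebesgue measure it suffices to compare the two sides on intervals ]a, b],
    whose preimage has length (b - a) / |c|. For negative c the preimage is closed on the left and
    open on the right, hence the two cases. *)
Let lebphi : forall A, measurable A ->
  leb A = mscale (NngNum (normr_ge0 c)) (lebesgue_affine1 c d) A.
Proof.
apply: lebesgue_measure_unique => _ [[a b] _ <-] /=.
rewrite /mscale/= /lebesgue_affine1.
have [cN|cP|/eqP] := ltgtP c 0; last by rewrite (negbTE c0).
- rewrite (_ : affine1 c d @^-1` _ =
    `[(b - d) / c, (a - d) / c[%classic); last first.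
    apply/seteqP; split => x /=; rewrite /affine1 !in_itv/=.
      rewrite ler_ndivrMr// ltr_ndivlMr// => /andP[? ?].
      by apply/andP; split; lra.
    rewrite ler_ndivrMr// ltr_ndivlMr// => /andP[? ?].
    by apply/andP; split; lra.
  rewrite !lebesgue_measure_itv/= !lte_fin ltr_nM2r ?invr_lt0// ltrBlDr subrK.
  case: ifP => ab; last by rewrite mule0.
  rewrite -!EFinD -EFinM ltr0_norm//; congr EFin; field.
  by rewrite lt_eqF.
- rewrite (_ : affine1 c d @^-1` _ =
    `](a - d) / c, (b - d) / c]%classic); last first.
    apply/seteqP; split => x /=; rewrite /affine1 !in_itv/=.
      rewrite ler_pdivlMr// ltr_pdivrMr// => /andP[? ?].
      by apply/andP; split; lra.
    rewrite ler_pdivlMr// ltr_pdivrMr// => /andP[? ?].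
    by apply/andP; split; lra.
  rewrite !lebesgue_measure_itv/= !lte_fin ltr_pM2r ?invr_gt0// ltrBlDr subrK.
  case: ifP => ab; last by rewrite mule0.
  rewrite -!EFinD -EFinM gtr0_norm//; congr EFin; field.
  by rewrite gt_eqF.
Qed.

Lemma ge0_integral_affine (f : measurableTypeR R -> \bar R) :
  measurable_fun setT f -> (forall y, 0 <= f y)%E ->
  (\int[leb]_y f y = `|c|%:E * \int[leb]_x f (c * x + d)%R)%E.
Proof.
move=> mf f0.
rewrite (@eq_measure_integral _ _ _ _
  (mscale (NngNum (normr_ge0 c)) (lebesgue_affine1 c d))); last first.
  by move=> A mA _; exact: lebphi.
rewrite ge0_integral_mscale//=.
by rewrite (@ge0_integral_pushforward _ _ _ _ _ _ (measurable_affine1 c d)).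
Qed.

Lemma ge0_integral_affineV (f : measurableTypeR R -> \bar R) :
  measurable_fun setT f -> (forall y, 0 <= f y)%E ->
  (\int[leb]_x f (c * x + d)%R = `|c^-1|%:E * \int[leb]_y f y)%E.
Proof.
move=> mf f0.
rewrite [in RHS]ge0_integral_affine// muleA -EFinM -normrM mulVf//.
by rewrite normr1 mul1e.
Qed.

End affine_substitution.

(** * Rotation invariance of the standard Gaussian measure on the plane *)

Section rotation.
Context (R : realType).
Local Notation B := (measurableTypeR R).
Local Notation leb := (@lebesgue_measure R).
Local Notation N := (@normal_prob R 0 1).

Lemma measurable_lin2 (a b : R) :
  measurable_fun setT (fun z : B * B => (a * z.1 + b * z.2 : B)).
Proof. by apply: measurable_funD; exact: measurable_funM. Qed.

Lemma measurable_map2 (a b c d : R) :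
  measurable_fun setT
    (fun z : B * B => (a * z.1 + b * z.2, c * z.1 + d * z.2) : B * B).
Proof. apply/measurable_fun_pairP; split; exact: measurable_lin2. Qed.

(** A rotation with c != 0 is a composition of two substitutions in one variable each. For fixed y,
    put x' = c x - s y; then s x + c y = (s / c) x' + y / c because c^2 + s^2 = 1. After exchanging
    the integrals, the second substitution is affine in y for fixed x'. The factors 1 / |c| and |c|
    cancel. *)
Lemma lebesgue_rotation (c s : R) (H : B * B -> \bar R) : c ^+ 2 + s ^+ 2 = 1 ->
  measurable_fun setT H -> (forall z, 0 <= H z)%E ->
  (\int[leb]_x \int[leb]_y H (c * x + - s * y, s * x + c * y)%R =
   \int[leb]_x \int[leb]_y H (x, y))%E.
Proof.
move=> cs mH H0.
rewrite (@fubini_tonelli _ _ _ _ _ leb leb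
  (fun z => H (c * z.1 + - s * z.2, s * z.1 + c * z.2))
  (measurableT_comp mH (measurable_map2 _ _ _ _)) (fun=> H0 _)).
have mHx x : measurable_fun setT (fun y => H (x, y)).
  by apply: measurableT_comp.
(* For c = 0 the map is a quarter turn: exchanging the integrals leaves only changes of sign. *)
have [c0|c0] := eqVneq c 0.
  have s2 : s ^+ 2 = 1 by rewrite -cs c0 expr0n add0r.
  have s0 : s != 0.
    apply/eqP => s0; move: s2; rewrite s0 expr0n => /esym/eqP.
    by rewrite oner_eq0.
  have s1 : `|s| = 1.
    by apply/eqP; rewrite -sqrp_eq1// real_normK ?num_real// s2.
  transitivity (\int[leb]_y \int[leb]_x H ((- s) * y + 0, x)%R)%E.
    apply: eq_integral => y _ /=.
    have := @ge0_integral_affineV _ s 0 s0 (fun x => H (- s * y + 0, x)%R)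
      (mHx _) (fun=> H0 _).
    rewrite normfV s1 invr1 mul1e => <-; apply: eq_integral => x _.
    by rewrite c0 !mul0r add0r !addr0.
  rewrite (@ge0_integral_affineV _ (- s) 0 _ (fun y => \int[leb]_x H (y, x)))%E.
  - by rewrite normfV normrN s1 invr1 mul1e.
  - by rewrite oppr_eq0.
  - exact: measurable_fun_fubini_tonelli_F.
  - by move=> y; exact: integral_ge0.
pose K (z : B * B) := H (z.1, (s / c) * z.1 + c^-1 * z.2)%R.
have K0 z : (0 <= K z)%E by exact: H0.
have mK : measurable_fun setT K.
  apply: measurableT_comp => //; apply/measurable_fun_pairP; split.
    exact: measurable_fst.
  exact: measurable_lin2.
transitivity (\int[leb]_y (`|c^-1|%:E *
   \int[leb]_x H (x, (s / c) * x + c^-1 * y)%R))%E.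
  apply: eq_integral => y _.
  rewrite -(@ge0_integral_affineV _ c (- s * y) c0
    (fun x => H (x, (s / c) * x + c^-1 * y)%R))//; last first.
    exact: measurableT_comp mK (measurable_pair2 _).
  apply: eq_integral => x _; congr (H (_, _)).
  rewrite /= (_ : c^-1 * y = (c ^+ 2 + s ^+ 2) / c * y); last first.
    by rewrite cs mul1r.
  field.
  exact: c0.
rewrite ge0_integralZl//; last 2 first.
- exact: (measurable_fun_fubini_tonelli_G K).
- by move=> y _; apply: integral_ge0 => x _; exact: H0.
rewrite -(@fubini_tonelli _ _ _ _ _ leb leb K mK K0).
rewrite -ge0_integralZl//; last 2 first.
- exact: (measurable_fun_fubini_tonelli_F K).
- by move=> y _; apply: integral_ge0 => x _; exact: H0.
apply: eq_integral => x _ /=.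
under eq_integral do rewrite /K /= addrC.
rewrite (@ge0_integral_affineV _ c^-1 _ _ _ (mHx x))// ?invr_eq0//.
by rewrite muleA -EFinM -normrM divff ?normr1 ?mul1e// invr_eq0.
Qed.

Lemma integral_normal (f : B -> \bar R) :
  measurable_fun setT f -> (forall y, 0 <= f y)%E ->
  (\int[N]_x f x = \int[leb]_x ((normal_pdf 0 1 x)%:E * f x))%E.
Proof.
move=> mf f0.
rewrite -(@ge0_integral_density _ _ _ _ R leb N idfun (normal_pdf 0 1))//.
- exact: measurable_id.
- exact: measurable_normal_pdf.
- exact: normal_pdf_ge0.
Qed.

Lemma integral_normal2 (G : B * B -> \bar R) :
  measurable_fun setT G -> (forall z, 0 <= G z)%E ->
  (\int[N]_x \int[N]_y G (x, y) = \int[leb]_x \int[leb]_y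
    ((normal_pdf 0 1 x * normal_pdf 0 1 y)%:E * G (x, y)))%E.
Proof.
move=> mG G0.
have mGx x : measurable_fun setT (fun y => G (x, y)) by exact: measurableT_comp.
rewrite integral_normal.
- apply: eq_integral => x _; rewrite integral_normal//.
  rewrite -ge0_integralZl//.
  + by apply: eq_integral => y _; rewrite muleA.
  + apply: emeasurable_funM => //; apply/measurable_EFinP.
    exact: measurable_normal_pdf.
  + by move=> y _; rewrite mule_ge0// lee_fin normal_pdf_ge0.
  + by rewrite lee_fin normal_pdf_ge0.
- exact: (@measurable_fun_fubini_tonelli_F _ _ _ _ _ N).
- by move=> x; exact: integral_ge0.
Qed.

(** The joint density depends on x^2 + y^2 only, which a rotation preserves, as it does Lebesgue
    measure. *)
Lemma normal_rotation (c s : R) (G : B * B -> \bar R) : c ^+ 2 + s ^+ 2 = 1 ->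
  measurable_fun setT G -> (forall z, 0 <= G z)%E ->
  (\int[N]_x \int[N]_y G (c * x + - s * y, s * x + c * y)%R =
   \int[N]_x \int[N]_y G (x, y))%E.
Proof.
move=> cs mG G0.
rewrite (@integral_normal2 (fun z =>
  G (c * z.1 + - s * z.2, s * z.1 + c * z.2)%R))//; last first.
  exact: measurableT_comp mG (measurable_map2 _ _ _ _).
rewrite (integral_normal2 mG G0).
pose H (z : B * B) := ((normal_pdf 0 1 z.1 * normal_pdf 0 1 z.2)%:E * G z)%E.
have mH : measurable_fun setT H.
  apply: emeasurable_funM => //; apply/measurable_EFinP.
  apply: measurable_funM.
    by apply: measurableT_comp => //; exact: measurable_normal_pdf.
  by apply: measurableT_comp => //; exact: measurable_normal_pdf.
have H0 z : (0 <= H z)%E.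
  by rewrite mule_ge0// lee_fin mulr_ge0 ?normal_pdf_ge0.
rewrite -[RHS](lebesgue_rotation cs mH H0).
apply: eq_integral => x _; apply: eq_integral => y _ /=; congr (_%:E * _)%E.
rewrite /= !normal_pdfE ?oner_eq0//= /normal_fun !subr0.
rewrite mulrACA -expRD [RHS]mulrACA -expRD; congr (_ * expR _).
rewrite -!mulrDl -!opprD; congr (- _ / _).
rewrite -[LHS]mul1r -cs; ring.
Qed.

End rotation.

(** * Gaussian pairs in triangular form *)

Section gaussian_pair.
Context (R : realType).
Local Notation B := (measurableTypeR R).
Local Notation N := (@normal_prob R 0 1).

(** A rotation takes (a x + b y) / g as its first coordinate, and the second one integrates out. If
    g = 0, then a = b = 0 and both sides are F(0). *)
Lemma normal_convolution (a b g : R) (F : B -> \bar R) :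
  a ^+ 2 + b ^+ 2 = g ^+ 2 ->
  measurable_fun setT F -> (forall z, 0 <= F z)%E ->
  (\int[N]_x \int[N]_y F (a * x + b * y)%R = \int[N]_x F (g * x)%R)%E.
Proof.
move=> abg mF F0; have [g0|g0] := eqVneq g 0.
  move/eqP: abg; rewrite g0 expr0n paddr_eq0 ?sqr_ge0// !sqrf_eq0.
  move=> /andP[/eqP -> /eqP ->].
  under eq_integral => x _.
    under eq_integral do rewrite !mul0r addr0.
    rewrite (integral_probability_cst N); over.
  by under [RHS]eq_integral do rewrite mul0r.
have cs : (a / g) ^+ 2 + (- (b / g)) ^+ 2 = 1.
  by rewrite sqrrN !expr_div_n -mulrDl abg divff// sqrf_eq0.
pose G (z : B * B) := F (g * z.1).
have mG : measurable_fun setT G.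
  by apply: measurableT_comp => //; exact: measurable_funM.
transitivity (\int[N]_x \int[N]_y G (x, y))%E; last first.
  by apply: eq_integral => x _; rewrite /G /= (integral_probability_cst N).
rewrite -(normal_rotation cs mG (fun=> F0 _)).
apply: eq_integral => x _; apply: eq_integral => y _; congr F => /=.
by field.
Qed.

(** Normal form of a centred Gaussian pair: its covariance matrix has diagonal entries p^2 and q^2 +
    r^2, and off-diagonal entry p q. Degenerate pairs are included. *)
Definition canonical_pair (p q r : R) (F : B * B -> \bar R) : \bar R :=
  (\int[N]_x \int[N]_y F (p * x, q * x + r * y)%R)%E.

(* Adding one more Gaussian coordinate to a pair that is already in the
   triangular form (p X, q X + r Y). *)
Lemma canonical_pair_absorb (a b p q r P Q T : R) (F : B * B -> \bar R) :
  P ^+ 2 = a ^+ 2 + p ^+ 2 -> P * Q = a * b + p * q ->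
  Q ^+ 2 + T ^+ 2 = b ^+ 2 + q ^+ 2 + r ^+ 2 ->
  measurable_fun setT F -> (forall z, 0 <= F z)%E ->
  (\int[N]_z canonical_pair p q r (fun w => F (a * z + w.1, b * z + w.2)%R) =
   canonical_pair P Q T F)%E.
Proof.
move=> PE PQ QT mF F0; rewrite /canonical_pair /=.
have mF2 u : measurable_fun setT (fun v => F (u, v)) by exact: measurableT_comp.
have mD (c : B) : measurable_fun setT (fun v : B => (c + v : B)).
  exact: measurable_funD.
(* If P = 0, the first coordinate vanishes and all Gaussian terms of the second one merge into a
   single one. *)
have [P0|P0] := eqVneq P 0.
  have [-> ->] : a = 0 /\ p = 0.
    move/eqP: PE; rewrite P0 expr0n eq_sym paddr_eq0 ?sqr_ge0// !sqrf_eq0.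
    by move=> /andP[/eqP -> /eqP ->].
  rewrite P0; pose t := Num.sqrt (q ^+ 2 + r ^+ 2).
  have tE : q ^+ 2 + r ^+ 2 = t ^+ 2 by rewrite sqr_sqrtr// addr_ge0 ?sqr_ge0.
  pose g := Num.sqrt (Q ^+ 2 + T ^+ 2).
  have gE : Q ^+ 2 + T ^+ 2 = g ^+ 2 by rewrite sqr_sqrtr// addr_ge0 ?sqr_ge0.
  have btg : b ^+ 2 + t ^+ 2 = g ^+ 2 by rewrite -gE QT -tE addrA.
  transitivity (\int[N]_x F (0, g * x)%R)%E.
    rewrite -(normal_convolution btg (mF2 0) (fun=> F0 _)).
    apply: eq_integral => z _.
    rewrite -(normal_convolution tE (measurableT_comp (mF2 0) (mD (b * z)))
      (fun=> F0 _)).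
    apply: eq_integral => x _; apply: eq_integral => y _ /=.
    by rewrite !mul0r addr0.
  rewrite -(normal_convolution gE (mF2 0) (fun=> F0 _)).
  by apply: eq_integral => x _; apply: eq_integral => y _; rewrite !mul0r.
(* Rotating (z, x) to (u, v) with a z + p x = P u gives b z + q x = Q u + t v for this t. Then t v +
   r y merges into one Gaussian term of variance T^2. *)
pose t := (q * a - b * p) / P.
have cs : (a / P) ^+ 2 + (- (p / P)) ^+ 2 = 1.
  by rewrite sqrrN !expr_div_n -mulrDl -PE divff// sqrf_eq0.
have tT : t ^+ 2 + r ^+ 2 = T ^+ 2.
  suff : P ^+ 2 * (t ^+ 2 + r ^+ 2) = P ^+ 2 * T ^+ 2.
    by apply: mulfI; rewrite sqrf_eq0.
  have -> : T ^+ 2 = b ^+ 2 + q ^+ 2 + r ^+ 2 - Q ^+ 2.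
    by rewrite -QT addrAC subrr add0r.
  rewrite mulrBr -[P ^+ 2 * Q ^+ 2]exprMn PQ mulrDr.
  have -> : P ^+ 2 * t ^+ 2 = (q * a - b * p) ^+ 2.
    by rewrite -exprMn /t mulrC divfK.
  by rewrite PE; ring.
pose K (w : B * B) := (\int[N]_y F (P * w.1, Q * w.1 + t * w.2 + r * y)%R)%E.
have mK : measurable_fun setT K.
  apply: (measurable_fun_fubini_tonelli_F
    (fun z : (B * B) * B =>
      F (P * z.1.1, Q * z.1.1 + t * z.1.2 + r * z.2)%R)) => //.
  apply: measurableT_comp => //; apply: measurable_fun_pair.
    by apply: measurable_funM => //; exact: measurableT_comp.
  apply: measurable_funD; last exact: measurable_funM.
  exact: (measurableT_comp (measurable_lin2 Q t) measurable_fst).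
have K0 w : (0 <= K w)%E by exact: integral_ge0.
transitivity (\int[N]_u \int[N]_v K (u, v))%E.
  rewrite -[RHS](normal_rotation cs mK K0).
  apply: eq_integral => z _; apply: eq_integral => x _.
  apply: eq_integral => y _.
  congr (F (_, _)) => /=; first by field.
  rewrite addrA; congr (_ + _).
  have -> : Q = (a * b + p * q) / P by rewrite -PQ mulrC mulKf.
  have -> : b * z + q * x = (a ^+ 2 + p ^+ 2) * (b * z + q * x) / P ^+ 2.
    by rewrite -PE mulrAC divff ?mul1r// sqrf_eq0.
  rewrite /t.
  by field.
apply: eq_integral => u _.
rewrite -(normal_convolution tT (measurableT_comp (mF2 (P * u)) (mD (Q * u)))
  (fun=> F0 _)).
by apply: eq_integral => v _; apply: eq_integral => y _ /=; rewrite addrA.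
Qed.

(** This is the Cholesky factorization of the Gram matrix of two vectors, built one coordinate at a
    time as in [canonical_pair_absorb]. The step rests on the Lagrange identity (x y + p q)^2 + (q x
    - y p)^2 = (x^2 + p^2) (y^2 + q^2). *)
Lemma canonical_pair_exists m (a b : 'I_m -> R) : exists p q r,
  [/\ p ^+ 2 = \sum_i a i ^+ 2, p * q = \sum_i a i * b i
    & q ^+ 2 + r ^+ 2 = \sum_i b i ^+ 2].
Proof.
elim: m a b => [|m IH] a b.
  by exists 0, 0, 0; rewrite !big_ord0 expr0n mulr0 addr0.
have [p [q [r [pE qE rE]]]] := IH (a \o lift ord0) (b \o lift ord0).
rewrite !big_ord_recl -pE -qE -rE.
set x := a ord0; set y := b ord0.
pose P := Num.sqrt (x ^+ 2 + p ^+ 2).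
have PE : P ^+ 2 = x ^+ 2 + p ^+ 2 by rewrite sqr_sqrtr// addr_ge0 ?sqr_ge0.
have [P0|P0] := eqVneq P 0.
  exists 0, 0, (Num.sqrt (y ^+ 2 + (q ^+ 2 + r ^+ 2))).
  move/esym/eqP: PE; rewrite P0 expr0n paddr_eq0 ?sqr_ge0// !sqrf_eq0.
  move=> /andP[/eqP -> /eqP ->]; rewrite !mul0r expr0n/= addr0 add0r.
  by rewrite sqr_sqrtr// !addr_ge0 ?sqr_ge0.
pose t := (q * x - y * p) / P.
exists P, ((x * y + p * q) / P), (Num.sqrt (t ^+ 2 + r ^+ 2)); split => //.
  by rewrite mulrC divfK.
rewrite sqr_sqrtr ?addr_ge0 ?sqr_ge0// !addrA; congr (_ + _).
rewrite /t !expr_div_n -mulrDl.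
rewrite [X in X / _](_ : _ = (y ^+ 2 + q ^+ 2) * P ^+ 2); last first.
  by rewrite PE; ring.
by rewrite mulfK// sqrf_eq0.
Qed.

End gaussian_pair.

(** * Integrals over tuples of independent variables *)

Section iid_integral.
Context d (T : measurableType d) (R : realType) (P : probability T R).
Local Open Scope ereal_scope.

Lemma integral_iid0 (f : 0.-tuple T -> \bar R) :
  measurable_fun setT f -> (forall x, 0 <= f x) ->
  \int[iid P 0]_x f x = f [tuple].
Proof. by move=> mf f0; rewrite /= integral_dirac// diracT mul1e. Qed.

Lemma integral_iidS n (f : n.+1.-tuple T -> \bar R) :
  measurable_fun setT f -> (forall x, 0 <= f x) ->
  \int[iid P n.+1]_x f x =
  \int[P]_z \int[iid P n]_t f [tuple of z :: t].
Proof.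
move=> mf f0.
rewrite /= ge0_integral_distribution// fubini_tonelli1//; last first.
  by move=> x; exact: f0.
by apply: measurableT_comp => //; exact: measurable_tcons.
Qed.

End iid_integral.

Section iid_normal.
Context (R : realType).
Local Notation B := (measurableTypeR R).
Local Notation N := (@normal_prob R 0 1).

Lemma measurable_dot m (a : 'I_m -> R) :
  measurable_fun setT (fun t : m.-tuple B => \sum_i a i * tnth t i : B).
Proof.
apply: measurable_sum => i; apply: measurable_funM => //.
exact: measurable_tnth.
Qed.

(** Since p, q, r are any solution of the three equations, the law of the two linear forms is seen
    to depend on their Gram matrix alone. By induction, the first variable is integrated last and
    absorbed into a triangular form of the others. *)
Lemma integral_iid_normal m (a b : 'I_m -> R) (p q r : R)
    (F : B * B -> \bar R) :
  p ^+ 2 = \sum_i a i ^+ 2 -> p * q = \sum_i a i * b i ->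
  q ^+ 2 + r ^+ 2 = \sum_i b i ^+ 2 ->
  measurable_fun setT F -> (forall z, 0 <= F z)%E ->
  (\int[iid N m]_t F (\sum_i a i * tnth t i, \sum_i b i * tnth t i)%R =
   canonical_pair p q r F)%E.
Proof.
elim: m a b p q r F => [|m IH] a b p q r F pE pqE qrE mF F0.
  rewrite integral_iid0//; last first.
    apply: measurableT_comp => //.
    by apply: measurable_fun_pair; exact: measurable_dot.
  move: pE qrE; rewrite !big_ord0 => /eqP; rewrite sqrf_eq0 => /eqP -> /eqP.
  rewrite paddr_eq0 ?sqr_ge0// !sqrf_eq0 => /andP[/eqP -> /eqP ->].
  rewrite /canonical_pair -[LHS](integral_probability_cst N).
  apply: eq_integral => x _; rewrite -[LHS](integral_probability_cst N).
  by apply: eq_integral => y _; rewrite !mul0r addr0.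
rewrite integral_iidS//; last first.
  apply: measurableT_comp => //.
  by apply: measurable_fun_pair; exact: measurable_dot.
have [p' [q' [r' [pE' qE' rE']]]] :=
  canonical_pair_exists (a \o lift ord0) (b \o lift ord0).
rewrite -(@canonical_pair_absorb _ (a ord0) (b ord0) p' q' r')//; last 3 first.
- by rewrite pE pE' big_ord_recl.
- by rewrite pqE qE' big_ord_recl.
- by rewrite qrE -addrA rE' big_ord_recl.
apply: eq_integral => z _.
rewrite -(@IH (a \o lift ord0) (b \o lift ord0))//; last first.
  apply: measurableT_comp => //; apply: measurable_fun_pair.
    by apply: measurable_funD => //; exact: measurable_fst.
  by apply: measurable_funD => //; exact: measurable_snd.
apply: eq_integral => t _ /=; rewrite !big_ord_recl !tnth0.
by congr (F (_ + _, _ + _)); apply: eq_bigr => i _; rewrite tnthS.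
Qed.

End iid_normal.

(* Cholesky factorization; when the pivot vanishes, so does its column. *)
Lemma psd_factor (R : realType) n (S : 'M[R]_n) :
  psd S -> exists A : 'M[R]_n, A *m A^T = S.
Proof.
elim: n S => [|n IH] S [Ssym Spos].
  by exists 0; apply/matrixP => -[].
rewrite -[S](@submxK _ 1 n 1 n) in Ssym Spos *.
set a := ulsubmx _ in Ssym Spos *; set b := ursubmx _ in Ssym Spos *.
set c := dlsubmx _ in Ssym Spos *; set D := drsubmx _ in Ssym Spos *.
clearbody a b c D.
move: Ssym; rewrite (@tr_block_mx _ 1 n 1 n).
move=> /(@eq_block_mx _ 1 n 1 n)[_ cb _ Dsym].
(* Positivity is restated on the vectors (x, v), as a quadratic polynomial in the pivot coordinate
   x. *)
have {}Spos x (v : 'cV_n) :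
    0 <= (x ^+ 2 * a 0 0 + x * ((c^T *m v) 0 0 *+ 2) + (v^T *m D *m v) 0 0).
  have := Spos (@col_mx _ 1 n 1 x%:M v).
  rewrite (@tr_col_mx _ 1 n 1) (@mul_row_block _ 1 1 n 1 n).
  rewrite (@mul_row_col _ 1 1 n 1).
  rewrite -cb tr_scalar_mx !mulmxDl !mul_scalar_mx -!scalemxAl !mul_mx_scalar.
  have -> : v^T *m c = c^T *m v.
    have tr1 (M : 'M[R]_1) : M^T = M by apply/matrixP => i j; rewrite mxE !ord1.
    by rewrite -[LHS]tr1 trmx_mul trmxK.
  rewrite !mxE => h; apply: le_trans h _; rewrite le_eqVlt; apply/orP; left.
  by apply/eqP; rewrite ?mulr1n; ring.
have Dpos (v : 'cV_n) : 0 <= (v^T *m D *m v) 0 0.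
  by have := Spos 0 v; rewrite expr0n !mul0r !add0r.
have a0 : 0 <= a 0 0.
  have z00 : (0 : 'M[R]_1) 0 0 = 0 by rewrite mxE.
  have := Spos 1 0.
  by rewrite !mulmx0 z00 mul0rn mulr0 addr0 expr1n mul1r addr0.
have [a_eq0|a_neq0] := eqVneq (a 0 0) 0.
  have c0 : c = 0.
    have nn : (c^T *m c) 0 0 = \sum_i c i 0 ^+ 2.
      by rewrite mxE; apply: eq_bigr => i _; rewrite mxE expr2.
    have nn0 : (c^T *m c) 0 0 = 0.
      apply/eqP; rewrite eq_le; apply/andP; split; last first.
        by rewrite nn sumr_ge0// => i _; rewrite sqr_ge0.
      rewrite leNgt; apply/negP => pos.
      (* With e = c^T D c >= 0, this choice of x makes the quadratic form equal to - e - 2, a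
         contradiction. *)
      have := Spos (- ((c^T *m D *m c) 0 0 + 1) / ((c^T *m c) 0 0)) c.
      rewrite a_eq0 mulr0 add0r mulrnAr divfK ?gt_eqF//.
      have := Dpos c; move: (_ 0 0); clear=> e; lra.
    apply/matrixP => i j; rewrite ord1 [RHS]mxE; apply/eqP; rewrite -sqrf_eq0.
    move/eqP: nn0; rewrite nn psumr_eq0; last by move=> k _; exact: sqr_ge0.
    by move=> /allP/(_ i); rewrite mem_index_enum => /(_ isT).
  have [|L LL] := IH D; first by split.
  exists (@block_mx _ 1 n 1 n 0 0 0 L).
  rewrite (@tr_block_mx _ 1 n 1 n) (@mulmx_block _ 1 n 1 n 1 n) !trmx0.
  rewrite !mulmx0 !mul0mx !add0r LL -cb c0 trmx0.
  by have -> : a = 0 by apply/matrixP => i j; rewrite !ord1 a_eq0 mxE.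
have apos : 0 < a 0 0 by rewrite lt_neqAle eq_sym a_neq0.
(* The induction continues with the Schur complement of the pivot. It is positive semidefinite
   because its form at v is the minimum over x of the quadratic polynomial, reached at x = - (c^T v)
   / a. *)
have [|L LL] := IH (D - (a 0 0)^-1 *: (c *m c^T)).
  split.
    by rewrite linearB/= linearZ/= trmx_mul trmxK Dsym.
  move=> v.
  have := Spos (- (a 0 0)^-1 * (c^T *m v) 0 0) v.
  rewrite mulmxBr mulmxBl -scalemxAr -scalemxAl.
  have -> : v^T *m (c *m c^T) *m v = (c^T *m v)^T *m (c^T *m v).
    by rewrite trmx_mul trmxK !mulmxA.
  set e := c^T *m v; move=> h; apply: le_trans h _.
  rewrite !mxE big_ord1 !mxE le_eqVlt; apply/orP; left; apply/eqP.
  by field.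
pose r := Num.sqrt (a 0 0).
have r0 : r != 0 by rewrite sqrtr_eq0 -ltNge.
have rr : r * r = a 0 0 by rewrite -expr2 sqr_sqrtr.
exists (@block_mx _ 1 n 1 n r%:M 0 (r^-1 *: c) L).
rewrite (@tr_block_mx _ 1 n 1 n) (@mulmx_block _ 1 n 1 n 1 n) !trmx0.
rewrite !mulmx0 !mul0mx !addr0 LL tr_scalar_mx -cb.
rewrite mul_scalar_mx mul_mx_scalar linearZ/= mul_scalar_mx !scalerA.
rewrite divff// !scale1r -scalemxAl -scalemxAr scalerA -invfM.
rewrite scale_scalar_mx rr addrC subrK.
have aE : a = (a 0 0)%:M by apply/matrixP => i j; rewrite !ord1 mxE eqxx.
by rewrite -aE.
Qed.

Section sigmoid.
Context (R : realType).
Implicit Types x y : R.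

Lemma sigmoid_gt0 x : 0 < sigmoid x.
Proof. by rewrite invr_gt0 addr_gt0// expR_gt0. Qed.

Lemma sigmoid_lt1 x : sigmoid x < 1.
Proof.
by rewrite invf_lt1 ?addr_gt0 ?expR_gt0// ltrDl expR_gt0.
Qed.

Lemma sigmoid_itv x : 0 <= sigmoid x <= 1.
Proof. by rewrite ltW ?sigmoid_gt0// ltW ?sigmoid_lt1. Qed.

Lemma ltr_sigmoid x y : x < y -> sigmoid x < sigmoid y.
Proof.
move=> xy; rewrite ltf_pV2 ?posrE ?addr_gt0 ?expR_gt0// ltrD2l.
by rewrite ltr_expR ltrN2.
Qed.

Lemma measurable_sigmoid : measurable_fun setT (@sigmoid R).
Proof.
apply: continuous_measurable_fun => x; apply: cvgV.
  by rewrite gt_eqF// addr_gt0// expR_gt0.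
apply: cvgD; first exact: cvg_cst.
apply: (@cvg_comp _ _ _ -%R expR); last exact: continuous_expR.
exact: cvgN cvg_id.
Qed.

End sigmoid.

(** * Pairs of coordinates of a multivariate normal vector *)

Section mvnormal_pair.
Context (R : realType) (n : nat).
Local Notation B := (measurableTypeR R).

(** Up to the mean, coordinates i and j are the linear forms given by rows i and j of the factor A.
    Their Gram matrix is read off S = A A^T, so the choice of the factor does not matter. *)
Lemma integral_mvnormal_pair (m : 'cV[R]_n) (S : 'M[R]_n) (i j : 'I_n)
    (p q r : R) (F : B * B -> \bar R) : psd S ->
  p ^+ 2 = S i i -> p * q = S i j -> q ^+ 2 + r ^+ 2 = S j j ->
  measurable_fun setT F -> (forall z, 0 <= F z)%E ->
  (\int[mvnormal m S]_x F (tnth x i, tnth x j) =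
   canonical_pair p q r (fun z => F (m i 0 + z.1, m j 0 + z.2)%R))%E.
Proof.
move=> psdS pE qE rE mF F0; rewrite /mvnormal.
set A := xget _ _.
(* A factor exists by [psd_factor], so [xget] does not fall back on its default 0. *)
have AE : A *m A^T = S.
  have [A0 A0E] := psd_factor psdS.
  exact: (@xgetPex _ 0 [set A : 'M[R]_n | A *m A^T = S] (ex_intro _ A0 A0E)).
have AijE k l : S k l = \sum_h A k h * A l h.
  by rewrite -AE mxE; apply: eq_bigr => h _; rewrite mxE.
rewrite ge0_integral_distribution//; last first.
  apply: measurableT_comp => //.
  by apply: measurable_fun_pair; exact: measurable_tnth.
rewrite -(@integral_iid_normal _ n (A i) (A j))//; last 4 first.
- by rewrite pE AijE; apply: eq_bigr => h _; rewrite expr2.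
- by rewrite qE AijE.
- by rewrite rE AijE; apply: eq_bigr => h _; rewrite expr2.
- apply: measurableT_comp => //; apply: measurable_fun_pair.
    by apply: measurable_funD => //; exact: measurable_fst.
  by apply: measurable_funD => //; exact: measurable_snd.
apply: eq_integral => t _ /=; rewrite !tnth_mktuple !mxE.
by congr (F (_ + _, _ + _)); apply: eq_bigr => h _; rewrite mxE.
Qed.

Lemma psd_pair_exists (S : 'M[R]_n) (i j : 'I_n) : psd S -> exists p q r,
  [/\ p ^+ 2 = S i i, p * q = S i j & q ^+ 2 + r ^+ 2 = S j j].
Proof.
move=> /psd_factor[A <-].
have [p [q [r [pE qE rE]]]] := canonical_pair_exists (A i) (A j).
exists p, q, r; split.
- by rewrite pE mxE; apply: eq_bigr => h _; rewrite mxE expr2.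
- by rewrite qE mxE; apply: eq_bigr => h _; rewrite mxE.
- by rewrite rE mxE; apply: eq_bigr => h _; rewrite mxE expr2.
Qed.

End mvnormal_pair.

Lemma psdZ (R : realType) n (c : R) (S : 'M[R]_n) :
  0 <= c -> psd S -> psd (c *: S).
Proof.
move=> c0 [Ssym Spos]; split; first by rewrite linearZ/= Ssym.
by move=> v; rewrite -scalemxAr -scalemxAl mxE mulr_ge0.
Qed.

(** The form is diagonal in x + y and x - y, with coefficients (1 + rho) / 2 and (1 - rho) / 2. *)
Lemma psd_corr2 (R : realType) (rho : R) : `|rho| <= 1 -> psd (corr2 rho).
Proof.
move=> rho1; split; first by apply/matrixP => i j; rewrite !mxE eq_sym.
move=> v; rewrite mxE !big_ord_recl big_ord0 !mxE !big_ord_recl !big_ord0.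
rewrite !mxE/=.
set x := v _ _; set y := v _ _.
have -> : (x * 1 + (y * rho + 0)) * x + ((x * rho + (y * 1 + 0)) * y + 0) =
    (1 + rho) / 2 * (x + y) ^+ 2 + (1 - rho) / 2 * (x - y) ^+ 2.
  by field.
move: rho1; rewrite ler_norml => /andP[r1 r2].
by rewrite addr_ge0// mulr_ge0 ?sqr_ge0//; lra.
Qed.

(** * The function D in terms of triangular Gaussian pairs *)

Section sigmoid_pair.
Context (R : realType).
Local Notation B := (measurableTypeR R).

Definition sigmoid2 (z : B * B) : \bar R := (sigmoid z.1 * sigmoid z.2)%:E.

Lemma measurable_sigmoid2 : measurable_fun setT sigmoid2.
Proof.
apply/measurable_EFinP; apply: measurable_funM.
  by apply: measurableT_comp => //; exact: measurable_sigmoid.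
by apply: measurableT_comp => //; exact: measurable_sigmoid.
Qed.

Lemma sigmoid2_ge0 z : (0 <= sigmoid2 z)%E.
Proof. by rewrite lee_fin mulr_ge0// ltW// sigmoid_gt0. Qed.

Variables (mu tau rho : R).
Hypotheses (tau0 : 0 < tau) (rho1 : `|rho| <= 1).

Lemma DfunE p q r :
  p ^+ 2 = tau^-1 -> p * q = tau^-1 * rho -> q ^+ 2 + r ^+ 2 = tau^-1 ->
  (Dfun mu tau rho)%:E =
  canonical_pair p q r (fun z => sigmoid2 (mu + z.1, mu + z.2)%R).
Proof.
move=> pE qE rE; rewrite /Dfun.
set E := ('E_ _ [_])%E.
have e : E =
  canonical_pair p q r (fun z => sigmoid2 (mu + z.1, mu + z.2)%R).
  rewrite /E unlock.
  have psdS : psd (tau^-1 *: corr2 rho).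
    by apply: psdZ; [rewrite invr_ge0 ltW|exact: psd_corr2].
  have S00 : p ^+ 2 = (tau^-1 *: corr2 rho) 0 0 by rewrite !mxE mulr1.
  have S01 : p * q = (tau^-1 *: corr2 rho) 0 1 by rewrite !mxE.
  have S11 : q ^+ 2 + r ^+ 2 = (tau^-1 *: corr2 rho) 1 1 by rewrite !mxE mulr1.
  have := integral_mvnormal_pair (const_mx mu) psdS S00 S01 S11
    measurable_sigmoid2 sigmoid2_ge0.
  by rewrite !mxE; exact.
(* The integrand lies in [0, 1], so the expectation is finite and [fine] in [Dfun] loses nothing. *)
rewrite e fineK// -e /E unlock.
apply: fin_num_integral_probability => [|x].
  apply: measurable_funM; apply: measurableT_comp => /=;
    by [exact: measurable_sigmoid|exact: measurable_tnth].
by rewrite /= mulr_ge0 ?mulr_ile1 ?ltW ?sigmoid_gt0 ?sigmoid_lt1.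
Qed.

End sigmoid_pair.

(** * Expectation of a product of functions of independent variables *)

Section expectation_product.
Context d (T : measurableType d) (R : realType) (P : probability T R).
Context d' (T' : measurableType d') (u : nat -> {RV P >-> T'}).
Hypothesis indep_u : mutually_independent u.
Variable k : nat.

Let ex (g : nat -> T' -> R) h := (\int[P]_w (g h (u h w))%:E)%E.

Lemma integral_prod_indic (B : nat -> set T') : (forall h, measurable (B h)) ->
  (\int[P]_w (\prod_(h < k) \1_(B h) (u h w))%:E =
   (\prod_(h < k) fine (ex (fun h => \1_(B h)) h))%:E)%E.
Proof.
(* [J] is {0, ..., k - 1} as a finite set, the form in which independence is stated. *)
move=> mB; pose J := [fset x in iota 0 k]%fset.
have big_J (F : nat -> R) : \prod_(h <- J) F h = \prod_(h < k) F h.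
  rewrite -(big_mkord xpredT) /index_iota subn0; apply: perm_big.
  apply: uniq_perm; rewrite ?fset_uniq ?iota_uniq// => x.
  by rewrite inE.
have mU h : measurable (u h @^-1` B h).
  by rewrite -[_ @^-1` _]setTI; exact: measurable_funP.
transitivity (P (\bigcap_(h in [set` J]) (u h @^-1` B h))).
  rewrite -[X in P X]setIT -integral_indic//; last first.
    by apply: fin_bigcap_measurable => //; exact: finite_fset.
  apply: eq_integral => w _; congr EFin.
  rewrite -(big_J (fun h => \1_(B h) (u h w))).
  have [h|h] := pselect ((\bigcap_(h in [set` J]) (u h @^-1` B h)) w).
    rewrite [RHS]indicE mem_set//= big_seq big1// => i iJ.
    by rewrite indicE mem_set//; exact: h.
  rewrite [RHS]indicE memNset//=; apply/eqP.
  move/existsNP: h => [i /not_implyP[iJ nB]].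
  by rewrite (big_rem i)//= indicE memNset// mul0r.
rewrite indep_u// (big_J (fun h => fine (P (u h @^-1` B h)))); congr EFin.
apply: eq_bigr => h _; congr fine.
by rewrite /ex -[X in P X]setIT -integral_indic.
Qed.

(* By induction on the number of factors that are not indicators. *)
Lemma integral_prod_indep (g : nat -> T' -> R) :
  (forall h, measurable_fun setT (g h)) ->
  (forall h x, 0 <= g h x <= 1) ->
  (\int[P]_w (\prod_(h < k) g h (u h w))%:E =
   (\prod_(h < k) fine (ex g h))%:E)%E.
Proof.
(* Factors with index in [m, k) are indicators and those below m are arbitrary; for m = k the
   condition is empty. *)
suff H m (f : nat -> T' -> R) (B : nat -> set T') :
    (forall h, measurable_fun setT (f h)) -> (forall h x, 0 <= f h x <= 1) ->
    (forall h, measurable (B h)) ->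
    (forall h, (m <= h < k)%N -> f h = \1_(B h)) ->
    (\int[P]_w (\prod_(h < k) f h (u h w))%:E =
     (\prod_(h < k) fine (ex f h))%:E)%E.
  move=> mg g01; apply: (H k _ (fun=> set0)) => // h.
  by rewrite leqNgt andNb.
elim: m f B => [|m IH] f B mf f01 mB fB.
  have fB' (h : 'I_k) : f h = \1_(B h) by apply: fB => /=.
  under eq_integral do under eq_bigr do rewrite fB'.
  rewrite integral_prod_indic//; congr EFin; apply: eq_bigr => h _.
  by rewrite /ex fB'.
have [km|mk] := leqP k m.
  apply: (IH f B) => // h /andP[mh hk].
  by have := leq_trans hk (leq_trans km mh); rewrite ltnn.
pose m' := Ordinal mk.
(* [G] collects all factors but number m, and [c] is the product of their expectations. *)
pose G w := \prod_(h < k | h != m') f h (u h w).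
pose c := \prod_(h < k | h != m') fine (ex f h).
have c0 : 0 <= c.
  apply: prodr_ge0 => h _; apply: fine_ge0; apply: integral_ge0 => w _.
  by rewrite lee_fin; have /andP[] := f01 h (u h w).
have mG : measurable_fun setT G.
  rewrite /G; under eq_fun do rewrite -big_filter.
  by apply: measurable_prod => h _; exact: measurableT_comp.
have G0 w : 0 <= G w.
  by apply: prodr_ge0 => h _; have /andP[] := f01 h (u h w).
have fu_fin : ex f m \is a fin_num.
  by apply: fin_num_integral_probability => //; exact: measurableT_comp.
transitivity (\int[P]_w ((G w)%:E * (f m (u m w))%:E))%E.
  by apply: eq_integral => w _; rewrite (bigD1 m')//= mulrC EFinM.
rewrite (bigD1 m')//= mulrC -/c EFinM fineK//.
(* The induction hypothesis with factor m replaced by the indicator of any measurable C says that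
   the law of u_m weighted by [G] is [c] times the law of u_m. The density lemma extends this from
   indicators to f_m. *)
rewrite (@ge0_integral_density _ _ _ _ R P
  (mscale (NngNum c0) (distribution P (u m))) (u m) G
  (measurable_funP (u m)) mG G0 _
  (EFin \o f m))//; last 3 first.
- move=> C mC.
  have mUC : measurable (u m @^-1` C).
    by rewrite -[_ @^-1` _]setTI; exact: measurable_funP.
  pose f' h := if h == m then (\1_C : T' -> R) else f h.
  pose B' h := if h == m then C else B h.
  have := IH f' B'; rewrite (bigD1 m')//=.
  rewrite (_ : \prod_(h < k | h != m') fine (ex f' h) = c); last first.
    apply: eq_bigr => h hm; rewrite /ex /f' ifN//.
  have -> : ex f' m = (\int[P]_w (\1_C (u m w))%:E)%E.
    by rewrite /ex /f' eqxx.
  move=> {}IH.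
  transitivity ((fine (P (u m @^-1` C)) * c)%:E)%E; last first.
    by rewrite mulrC EFinM fineK ?fin_num_measure.
  rewrite (_ : P (u m @^-1` C) = \int[P]_w (\1_C (u m w))%:E)%E; last first.
    by rewrite -[X in P X]setIT -integral_indic.
  rewrite -IH.
  + rewrite integral_mkcond epatch_indic; apply: eq_integral => w _.
    rewrite (bigD1 m')//= /f' eqxx mulrC EFinM; congr (_%:E * _)%E.
    by apply: eq_bigr => h hm; rewrite ifN.
  + by move=> h; rewrite /f'; case: ifP => // _; exact: measurable_indic.
  + move=> h x; rewrite /f'; case: ifP => // _; rewrite indicE.
    by case: (_ \in _); rewrite /= lexx ler01.
  + by move=> h; rewrite /B'; case: ifP.
  + move=> h; rewrite /f' /B'; case: eqP => // /eqP hm /andP[mh hk].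
    by apply: fB; rewrite hk andbT ltn_neqAle eq_sym hm.
- exact/measurable_EFinP.
- by move=> x; rewrite lee_fin; have /andP[] := f01 m x.
rewrite ge0_integral_mscale//=; last 2 first.
- exact/measurable_EFinP.
- by move=> x _; rewrite lee_fin; have /andP[] := f01 m x.
rewrite ge0_integral_distribution//.
- exact/measurable_EFinP.
- by move=> x; rewrite lee_fin; have /andP[] := f01 m x.
Qed.

End expectation_product.

(** * The joint probability in the sIBP *)

Section joint_probability.
Context (R : realType) (mu tau : R) (n : nat) (Q : 'M[R]_n).
Context d (T : measurableType d) (P : probability T R).
Variables (u : nat -> {RV P >-> n.-tuple R}).
Variables (z : 'I_n -> nat -> {RV P >-> bool}).
Hypotheses (tau0 : 0 < tau) (psdQ : psd Q) (uz : sIBP mu tau Q u z).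
Hypothesis diagQ : forall i, Q i i = 1.
Variables (i j : 'I_n).
Hypothesis ij : i != j.

Let sig2 (x : n.-tuple R) : R := sigmoid (tnth x i) * sigmoid (tnth x j).

Let measurable_sig2 : measurable_fun setT sig2.
Proof.
apply: measurable_funM; apply: measurableT_comp; try exact: measurable_sigmoid.
  exact: measurable_tnth.
exact: measurable_tnth.
Qed.

Lemma stick_itv k w l : 0 <= stick u l k w <= 1.
Proof.
rewrite prodr_ge0//=; last by move=> h _; rewrite ltW// sigmoid_gt0.
by apply: prodr_ile1 => h _; exact: sigmoid_itv.
Qed.

Lemma probability_both k :
  (P [set w | z i k w = true /\ z j k w = true] =
   \int[P]_w (\prod_(h < k.+1) sig2 (u h w))%:E)%E.
Proof.
(* The Bernoulli law gives {true} the mass [stick], which is a legitimate parameter as it lies in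
   [0, 1]. *)
have Y (p : 'I_n * nat) :
    is_cond_prob P (u_events u) (z p.1 p.2 @^-1` [set true]) (stick u p.1 p.2).
  have := sIBP_bernoulli uz p.1 p.2 (C := [set true]) I.
  congr is_cond_prob; apply/funext => w.
  rewrite bernoulli_probE ?stick_itv//.
  by rewrite !diracE mem_set// memNset// mule0 adde0 mule1.
have [_ _] := sIBP_cond_indep uz [fset (i, k); (j, k)]%fset
  (B := fun=> [set true]) (Y := fun p => stick u p.1 p.2) (fun=> I) Y.
(* Integrating the conditional probability over the whole space yields the unconditional one. *)
move=> /(_ setT) E; transitivity
  (P (\bigcap_(p in [set` [fset (i, k); (j, k)]%fset])
    (z p.1 p.2 @^-1` [set true]) `&` setT)).
  congr (P _); rewrite setIT; apply/seteqP; split => w /=.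
    by move=> [zi zj] p /=; rewrite !inE => /orP[] /eqP ->.
  by move=> zw; split; [apply: (zw (i, k))|apply: (zw (j, k))];
    rewrite /= !inE eqxx ?orbT.
rewrite -E; last first.
  exact: (@measurableT _ (g_sigma_algebraType (u_events u))).
apply: eq_integral => w _; congr EFin.
(* As i != j, the index set has two distinct elements and the product has both stick factors. *)
rewrite big_fsetU1/= ?big_seq_fset1; last first.
  by rewrite !inE xpair_eqE negb_and ij.
by rewrite -big_split.
Qed.

Lemma sIBP_joint k :
  P [set w | z i k w = true /\ z j k w = true] =
  (Dfun mu tau (Q i j) ^+ k.+1)%:E.
Proof.
rewrite probability_both.
rewrite (@integral_prod_indep _ _ _ _ _ _ _ (sIBP_indep uz) k.+1
  (fun=> sig2))//; last first.
  move=> _ x; rewrite mulr_ge0/= ?mulr_ile1 ?(ltW (sigmoid_gt0 _))//;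
    by rewrite ltW// sigmoid_lt1.
have psdS : psd (tau^-1 *: Q) by apply: psdZ => //; rewrite invr_ge0 ltW.
have [p [q [r [pE qE rE]]]] := psd_pair_exists i j psdS.
(* Cauchy-Schwarz in triangular form: p'^2 = 1 and q'^2 + r'^2 = 1 force |p' q'| <= 1. *)
have Qij : `|Q i j| <= 1.
  have [p' [q' [r' [p1 <-]]]] := psd_pair_exists i j psdQ; move: p1.
  rewrite !diagQ ler_norml => p1 qr1.
  by have := (sqr_ge0 (p' + q'), sqr_ge0 (p' - q'), sqr_ge0 r') => -[[]]; nra.
(* Coordinates i and j of u_h share their triangular coefficients with the bivariate normal law that
   defines D at Q i j. *)
have D h : (\int[P]_w (sig2 (u h w))%:E = (Dfun mu tau (Q i j))%:E)%E.
  transitivity (\int[distribution P (u h)]_x (sig2 x)%:E)%E.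
    rewrite ge0_integral_distribution//; first exact/measurable_EFinP.
    by move=> x; exact: (sigmoid2_ge0 (_, _)).
  transitivity (\int[mvnormal (const_mx mu) (tau^-1 *: Q)]_x (sig2 x)%:E)%E.
    by apply: eq_measure_integral => A mA _; exact: (sIBP_normal uz).
  have := integral_mvnormal_pair (const_mx mu) psdS pE qE rE
    (@measurable_sigmoid2 R) (@sigmoid2_ge0 R).
  move: pE qE rE; rewrite !mxE !diagQ mulr1 => pE qE rE.
  by rewrite (DfunE mu tau0 Qij pE qE rE); exact.
by under eq_bigr do rewrite D; rewrite prodr_const card_ord.
Qed.
End joint_probability.

(** * Strict inequalities for integrals of functions with values in [0, 1] *)

Section unit_interval_integral.
Context d (T : measurableType d) (R : realType) (P : probability T R).

(** This class is stable under products and under partial integration, and on it the real-valued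
    integral agrees with the extended one because everything is finite. *)
Definition unit_fun (f : T -> R) :=
  measurable_fun setT f /\ forall x, 0 <= f x <= 1.

Lemma EFin_Rintegral f :
  unit_fun f -> (\int[P]_x f x)%:E = (\int[P]_x (f x)%:E)%E.
Proof.
by move=> [mf f01]; rewrite fineK//; exact: fin_num_integral_probability.
Qed.

Lemma unit_funM f g : unit_fun f -> unit_fun g -> unit_fun (fun x => f x * g x).
Proof.
move=> [mf f01] [mg g01]; split; first exact: measurable_funM.
move=> x; have /andP[f0 f1] := f01 x; have /andP[g0 g1] := g01 x.
by rewrite mulr_ge0//= mulr_ile1.
Qed.

Lemma Rintegral_unit f : unit_fun f -> 0 <= \int[P]_x f x <= 1.
Proof.
move=> Uf; have [mf f01] := Uf.
rewrite -2!lee_fin EFin_Rintegral//; apply/andP; split.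
  by apply: integral_ge0 => x _; rewrite lee_fin; have /andP[] := f01 x.
rewrite -[leRHS](integral_probability_cst P 1).
apply: ge0_le_integral => //.
- by move=> x _; rewrite lee_fin; have /andP[] := f01 x.
- exact/measurable_EFinP.
- by move=> x _; rewrite lee_fin; have /andP[] := f01 x.
Qed.

(** Otherwise f would vanish almost everywhere, and A would lie in a null set. *)
Lemma integral_gt0 (A : set T) (f : T -> R) : measurable A -> (0 < P A)%E ->
  measurable_fun setT f -> (forall x, 0 <= f x) -> (forall x, A x -> 0 < f x) ->
  (0 < \int[P]_x (f x)%:E)%E.
Proof.
move=> mA PA mf f0 Af.
rewrite lt_neqAle eq_sym integral_ge0 ?andbT; last first.
  by move=> x _; rewrite lee_fin.
apply/eqP => If.
have := (@ae_eq_integral_abs _ _ _ P setT measurableT (EFin \o f)).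
have mEf : measurable_fun setT (EFin \o f) by exact/measurable_EFinP.
move=> /(_ mEf)[+ _].
under eq_integral do rewrite /= ger0_norm//.
move=> /(_ If) [N [mN N0 subN]].
have : (P A <= P N)%E.
  apply: le_measure; rewrite ?inE//.
  apply: subset_trans subN => x Ax /= /(_ I) [fx0].
  by have := Af x Ax; rewrite fx0 ltxx.
by rewrite N0 leNgt PA.
Qed.

Lemma Rintegral_lt f g : unit_fun f -> unit_fun g -> (forall x, f x < g x) ->
  \int[P]_x f x < \int[P]_x g x.
Proof.
move=> Uf Ug fg; have [[mf f01] [mg g01]] := (Uf, Ug).
have mgf : measurable_fun setT (fun x => g x - f x) by exact: measurable_funB.
have gf0 x : 0 <= g x - f x by rewrite subr_ge0 ltW.
have : (0 < \int[P]_x (g x - f x)%:E)%E.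
  apply: (integral_gt0 measurableT) => //; first by rewrite probability_setT.
  by move=> x _; rewrite subr_gt0.
have : (\int[P]_x (g x)%:E = \int[P]_x (f x)%:E + \int[P]_x (g x - f x)%:E)%E.
  rewrite -ge0_integralD//.
  - by apply: eq_integral => x _; rewrite -EFinD addrC subrK.
  - by move=> x _; rewrite lee_fin; have /andP[] := f01 x.
  - exact/measurable_EFinP.
  - by move=> x _; rewrite lee_fin.
  - exact/measurable_EFinP.
rewrite -lte_fin !EFin_Rintegral// => -> gf.
by rewrite lteDl// -EFin_Rintegral.
Qed.

(** The difference of the two sides is the variance of f, which is positive since f differs from its
    mean almost surely. *)
Lemma sqr_Rintegral_lt f :
  unit_fun f -> (forall m, P (f @^-1` [set m]) = 0%E) ->
  (\int[P]_x f x) ^+ 2 < \int[P]_x (f x ^+ 2).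
Proof.
move=> Uf fP; have [mf f01] := Uf.
have Uf2 : unit_fun (fun x => f x ^+ 2) by exact: unit_funM.
have f0 x : 0 <= f x by have /andP[] := f01 x.
set m := \int[P]_x f x.
have m0 : 0 <= m by have /andP[] := Rintegral_unit Uf.
have mA : measurable (f @^-1` [set m]).
  by rewrite -[_ @^-1` _]setTI; exact: mf.
have mfm : measurable_fun setT (fun x => (f x - m) ^+ 2).
  by apply: measurable_funX; exact: measurable_funB.
have V0 : (0 < \int[P]_x ((f x - m) ^+ 2)%:E)%E.
  apply: (@integral_gt0 (~` (f @^-1` [set m]))) => //.
  - exact: measurableC.
  - by rewrite probability_setC// fP sube0.
  - by move=> x; exact: sqr_ge0.
  - move=> x /eqP fm.
    by rewrite lt_neqAle sqr_ge0 andbT eq_sym sqrf_eq0 subr_eq0.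
(* The expansion of (f - m)^2 is arranged with nonnegative terms on both sides, so that additivity
   of nonnegative integrals suffices. *)
have : (\int[P]_x ((f x - m) ^+ 2)%:E + (m *+ 2)%:E * m%:E =
        \int[P]_x (f x ^+ 2)%:E + (m ^+ 2)%:E)%E.
  rewrite EFin_Rintegral// -ge0_integralZl//; last 3 first.
  - exact/measurable_EFinP.
  - by move=> x _; rewrite lee_fin.
  - by rewrite lee_fin mulrn_wge0.
  rewrite -ge0_integralD//; last 4 first.
  - by move=> x _; rewrite lee_fin sqr_ge0.
  - exact/measurable_EFinP.
  - by move=> x _; rewrite lee_fin mulr_ge0// mulrn_wge0.
  - by apply/measurable_EFinP; exact: measurable_funM.
  rewrite -[(m ^+ 2)%:E](integral_probability_cst P).
  rewrite -ge0_integralD//; last 3 first.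
  - by move=> x _; rewrite lee_fin sqr_ge0.
  - by apply/measurable_EFinP; exact: measurable_funX.
  - by move=> x _; rewrite lee_fin sqr_ge0.
  apply: eq_integral => x _; rewrite -EFinM -!EFinD; congr EFin; ring.
rewrite -(EFin_Rintegral Uf2) => e; rewrite -lte_fin.
have : (\int[P]_x ((f x - m) ^+ 2)%:E)%E = (\int[P]_x (f x ^+ 2) - m ^+ 2)%:E.
  move: e; case: (\int[P]_x _)%E => [v||]//=.
  rewrite -EFinM -!EFinD => -[e]; congr EFin.
  apply: (@addIr _ (m *+ 2 * m)); rewrite e; ring.
by move=> e'; move: V0; rewrite e' !lte_fin subr_gt0.
Qed.

End unit_interval_integral.

(** * Strict monotonicity of D *)

Section Dfun_monotone.
Context (R : realType).
Local Notation B := (measurableTypeR R).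
Local Notation N := (@normal_prob R 0 1).

Lemma normal_prob_set1 (x : B) : N [set x] = 0%E.
Proof.
have /null_content_dominatesP := @normal_prob_dominates R 0 1.
by apply => //; exact: lebesgue_measure_set1.
Qed.

(** A strictly increasing function takes each value at most once, and the normal law has no
    atoms. *)
Lemma normal_prob_preimage_set1 (f : B -> R) (m : R) :
  {homo f : x y / x < y} -> N (f @^-1` [set m]) = 0%E.
Proof.
move=> f_lt; have [[x fx]|nx] := pselect (exists x, f x = m).
  rewrite (_ : f @^-1` _ = [set x]) ?normal_prob_set1//.
  apply/seteqP; split => [y fy|y ->]//=.
  apply/eqP; move: fy => /=; rewrite -fx; apply: contra_eqT; rewrite neq_lt.
  by move=> /orP[] /f_lt; rewrite lt_neqAle => /andP[]// ; rewrite eq_sym.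
rewrite (_ : f @^-1` _ = set0) ?measure0//.
by apply/seteqP; split => // y fy; apply: nx; exists y.
Qed.

Lemma unit_fun_Rintegral d (T : measurableType d) (K : T * B -> R) :
  unit_fun K -> unit_fun (fun x => \int[N]_y K (x, y)).
Proof.
move=> [mK K01]; split => [|x]; last first.
  by apply: Rintegral_unit; split => //; exact: measurableT_comp.
apply: (measurableT_comp (@fine_measurable R _ measurableT)).
apply: (measurable_fun_fubini_tonelli_F (EFin \o K)).
  exact/measurable_EFinP.
by move=> z; rewrite lee_fin; have /andP[] := K01 z.
Qed.

Variables (mu tau : R).
Hypothesis tau0 : 0 < tau.
Let al := Num.sqrt tau^-1.

Let al2 : al ^+ 2 = tau^-1.
Proof. by rewrite sqr_sqrtr// invr_ge0 ltW. Qed.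

Let al_gt0 : 0 < al.
Proof. by rewrite sqrtr_gt0 invr_gt0. Qed.

Let sg (x : R) := sigmoid (mu + x).

Let unit_sg d (T : measurableType d) (f : T -> B) : measurable_fun setT f ->
  unit_fun (sg \o f).
Proof.
move=> mf; split => [|x]; last exact: sigmoid_itv.
apply: measurableT_comp => //.
apply: (measurableT_comp (@measurable_sigmoid R)).
exact: measurable_funD.
Qed.

Let F (z : B * B) := sigmoid2 (mu + z.1, mu + z.2)%R.

Let mF : measurable_fun setT F.
Proof.
apply: (measurableT_comp (@measurable_sigmoid2 R)); apply: measurable_fun_pair.
  by apply: measurable_funD => //; exact: measurable_fst.
by apply: measurable_funD => //; exact: measurable_snd.
Qed.

Let F0 z : (0 <= F z)%E.
Proof. exact: sigmoid2_ge0. Qed.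

Let unit_affine (a v : R) : unit_fun (fun x : B => sg (a + v * x)).
Proof.
apply: (@unit_sg _ _ (fun x => a + v * x)).
by apply: measurable_funD => //; exact: measurable_funM.
Qed.

(** With middle coefficient 0 the two coordinates are independent with the same law, so the double
    integral is a square. Here [a] stands for the part shared by both coordinates, held fixed. *)
Let independent_pair (a v : R) :
  canonical_pair v 0 v (fun z => F (a + z.1, a + z.2)%R) =
  ((\int[N]_x sg (a + v * x)) ^+ 2)%:E.
Proof.
rewrite /canonical_pair expr2 EFinM {1}(EFin_Rintegral _ (unit_affine a v)).
have [mf f01] := unit_affine a v.
have I0 : (0 <= (\int[N]_x sg (a + v * x))%:E)%E.
  by rewrite lee_fin; have /andP[] := Rintegral_unit N (unit_affine a v).
have mEf : measurable_fun setT (fun x : B => (sg (a + v * x))%:E).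
  exact/measurable_EFinP.
have Ef0 x : (0 <= (sg (a + v * x))%:E)%E.
  by rewrite lee_fin; have /andP[] := f01 x.
rewrite -(ge0_integralZr N measurableT mEf (fun x _ => Ef0 x) I0).
apply: eq_integral => x _; rewrite (EFin_Rintegral _ (unit_affine a v)).
rewrite -(ge0_integralZl N measurableT mEf (fun x _ => Ef0 x) (Ef0 x)).
by apply: eq_integral => y _; rewrite mul0r add0r -EFinM.
Qed.

Lemma Dfun_lt rho1 rho2 : 0 < rho1 -> rho1 < rho2 -> rho2 < 1 ->
  Dfun mu tau rho1 < Dfun mu tau rho2.
Proof.
move=> r1_gt0 r12 r2_lt1.
(* These are the standard deviations of the terms in W, in W' and in the private noise; [p] is that
   of the last two merged, as p^2 = t^2 + v^2. *)
pose s := al * Num.sqrt rho1; pose t := al * Num.sqrt (rho2 - rho1).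
pose v := al * Num.sqrt (1 - rho2); pose p := al * Num.sqrt (1 - rho1).
have sE : s ^+ 2 = tau^-1 * rho1 by rewrite exprMn al2 sqr_sqrtr// ltW.
have tE : t ^+ 2 = tau^-1 * (rho2 - rho1).
  by rewrite exprMn al2 sqr_sqrtr// subr_ge0 ltW.
have vE : v ^+ 2 = tau^-1 * (1 - rho2).
  by rewrite exprMn al2 sqr_sqrtr// subr_ge0 ltW.
have pE : p ^+ 2 = tau^-1 * (1 - rho1).
  by rewrite exprMn al2 sqr_sqrtr// subr_ge0 ltW// (lt_trans r12).
have t_gt0 : 0 < t by rewrite mulr_gt0// sqrtr_gt0 subr_gt0.
pose h (w w' : B) : R := \int[N]_x sg (s * w + t * w' + v * x).
have Uh : unit_fun (fun z : B * B => h z.1 z.2).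
  apply: (@unit_fun_Rintegral _ _ (fun z : (B * B) * B =>
    sg (s * z.1.1 + t * z.1.2 + v * z.2))).
  apply: (@unit_sg _ _ (fun z : (B * B) * B =>
    s * z.1.1 + t * z.1.2 + v * z.2)).
  apply: measurable_funD; last exact: measurable_funM.
  exact: (measurableT_comp (measurable_lin2 s t) measurable_fst).
have Uhw w : unit_fun (h w).
  split => [|w']; last exact: (Uh.2 (w, w')).
  exact: (measurableT_comp Uh.1 (measurable_pair1 w)).
pose H (w : B) : R := \int[N]_w' h w w'.
have UH : unit_fun H by exact: (unit_fun_Rintegral Uh).
have h_lt w : {homo h w : x y / x < y}.
  move=> x y xy; apply: Rintegral_lt; try exact: unit_affine.
  by move=> e; apply: ltr_sigmoid; rewrite ltrD2l ltrD2r ltrD2l ltr_pM2l.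
have mFa a : measurable_fun setT (fun z : B * B => F (a + z.1, a + z.2)%R).
  apply: (measurableT_comp mF); apply: measurable_fun_pair.
    by apply: measurable_funD => //; exact: measurable_fst.
  by apply: measurable_funD => //; exact: measurable_snd.
have psd_rho rho : `|rho| <= 1 -> psd (tau^-1 *: corr2 rho).
  by move=> r1; apply: psdZ; [rewrite invr_ge0 ltW|exact: psd_corr2].
have D2 : (Dfun mu tau rho2)%:E = (\int[N]_w \int[N]_w' (h w w' ^+ 2)%:E)%E.
  have r2_1 : `|rho2| <= 1 by rewrite ger0_norm ltW// (lt_trans r1_gt0).
  have [P [Q [T []]]] := psd_pair_exists 0 1 (psd_rho _ r2_1).
  rewrite !mxE/= mulr1 => PE QE TE; rewrite (DfunE mu tau0 r2_1 PE QE TE).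
  (* Triangular form of what remains once W is fixed: the two lists are the coefficients of W', X, Y
     in U and V. Absorption is then undone twice, first for W and then for W'. *)
  have [p1 [q1 [r1 []]]] := canonical_pair_exists
    (fun i : 'I_3 => [:: t; v; 0]`_i) (fun i : 'I_3 => [:: t; 0; v]`_i).
  rewrite !big_ord_recl !big_ord0/= expr0n/= mulr0 mul0r !addr0 add0r.
  move=> p1E q1E r1E.
  have PE' : P ^+ 2 = s ^+ 2 + p1 ^+ 2 by rewrite PE sE p1E tE vE; ring.
  have QE' : P * Q = s * s + p1 * q1 by rewrite QE q1E -!expr2 sE tE; ring.
  have TE' : Q ^+ 2 + T ^+ 2 = s ^+ 2 + q1 ^+ 2 + r1 ^+ 2.
    by rewrite TE -addrA r1E sE tE vE; ring.
  rewrite -(canonical_pair_absorb PE' QE' TE' mF F0).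
  apply: eq_integral => w _.
  have q1E' : p1 * q1 = t * t + v * 0 by rewrite q1E mulr0 addr0.
  have r1E' : q1 ^+ 2 + r1 ^+ 2 = t ^+ 2 + 0 ^+ 2 + v ^+ 2.
    by rewrite r1E expr0n addr0.
  rewrite -(canonical_pair_absorb p1E q1E' r1E' (mFa (s * w)) (fun=> F0 _)).
  apply: eq_integral => w' _; rewrite -[RHS]independent_pair.
  by congr canonical_pair; apply/funext => z; rewrite /F /= !addrA.
(* At rho1 only W is shared. The private term of deviation [p] is then split by [normal_convolution]
   into parts of deviations [t] and [v], which turns the inner integral into [H]. *)
have D1 : (Dfun mu tau rho1)%:E = (\int[N]_w (H w ^+ 2)%:E)%E.
  have r1_1 : `|rho1| <= 1 by rewrite ger0_norm ltW// (lt_trans r12).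
  have [P [Q [T []]]] := psd_pair_exists 0 1 (psd_rho _ r1_1).
  rewrite !mxE/= mulr1 => PE QE TE; rewrite (DfunE mu tau0 r1_1 PE QE TE).
  have PE' : P ^+ 2 = s ^+ 2 + p ^+ 2 by rewrite PE sE pE; ring.
  have QE' : P * Q = s * s + p * 0 by rewrite QE mulr0 addr0 -expr2 sE.
  have TE' : Q ^+ 2 + T ^+ 2 = s ^+ 2 + 0 ^+ 2 + p ^+ 2.
    by rewrite TE expr0n addr0 sE pE; ring.
  rewrite -(canonical_pair_absorb PE' QE' TE' mF F0).
  apply: eq_integral => w _; rewrite independent_pair; congr (_ ^+ 2)%:E.
  apply: EFin_inj; rewrite (EFin_Rintegral _ (unit_affine _ _)).
  rewrite -(@normal_convolution _ t v p
    (fun y => (sg (s * w + y))%:E)); last 3 first.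
  - by rewrite tE vE pE; ring.
  - apply/measurable_EFinP; have [+ _] := unit_affine (s * w) 1.
    by under eq_fun do rewrite mul1r.
  - by move=> y; rewrite lee_fin ltW// sigmoid_gt0.
  rewrite (EFin_Rintegral _ (Uhw w)); apply: eq_integral => w' _.
  rewrite (EFin_Rintegral _ (unit_affine _ _)).
  by apply: eq_integral => x _; rewrite addrA.
have U2 : unit_fun (fun w : B => \int[N]_w' (h w w' ^+ 2)).
  apply: (@unit_fun_Rintegral _ _ (fun z : B * B => h z.1 z.2 ^+ 2)).
  exact: unit_funM.
rewrite (_ : Dfun mu tau rho1 = \int[N]_w (H w ^+ 2)); last first.
  by apply: EFin_inj; rewrite D1 -EFin_Rintegral//; exact: unit_funM.
rewrite (_ : Dfun mu tau rho2 = \int[N]_w \int[N]_w' (h w w' ^+ 2)); last first.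
  apply: EFin_inj; rewrite D2 EFin_Rintegral//; apply: eq_integral => w _.
  exact: (esym (EFin_Rintegral N (unit_funM (Uhw w) (Uhw w)))).
(* The comparison holds for every fixed w, by positivity of the variance of [h w], and is then
   integrated over w. *)
apply: Rintegral_lt => //; first exact: unit_funM.
move=> w; apply: sqr_Rintegral_lt => // m.
exact: normal_prob_preimage_set1.
Qed.

End Dfun_monotone.

Theorem proposition3 (R : realType) (mu tau : R) (tau_gt0 : 0 < tau) :
  (forall (V : normedModType R) (Psi : Type) (rho : R -> Psi -> R) (psi : Psi)
      (n : nat) (s : 'I_n -> V)
      (d : measure_display) (T : measurableType d) (P : probability T R)
      (u : nat -> {RV P >-> n.-tuple R}) (z : 'I_n -> nat -> {RV P >-> bool}),
    injective s ->
    correlation_function V (rho^~ psi) ->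
    sIBP mu tau (corr_mx (rho^~ psi) s) u z ->
    forall (i j : 'I_n) (k : nat), i != j ->
      P [set w | z i k w = true /\ z j k w = true]
      = (Dfun mu tau (corr_mx (rho^~ psi) s i j) ^+ k.+1)%:E)
  /\ {in `]0, 1[ &, forall rho1 rho2 : R,
        rho1 < rho2 -> Dfun mu tau rho1 < Dfun mu tau rho2}.
Proof.
split; last first.
  move=> rho1 rho2; rewrite !in_itv/= => /andP[r1_gt0 _] /andP[_ r2_lt1] r12.
  exact: Dfun_lt.
move=> V Psi rho psi n s d T P u z _ [r0 corr_psd] uz i j k ij.
apply: (sIBP_joint tau_gt0 (corr_psd n s) uz) => // l.
by rewrite mxE subrr normr0.
Qed.
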